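(* Suppose that $(Y(t))_{t\in\mathbb{R}^d}$ is a causal CARMA$(p,q)$ random field on $\mathbb{R}^d$ such that $A_1=\cdots=A_d$ and such that the polynomials $a_1(\cdot)$ and $b(z)=b_0+b_1z+\cdots+b_{p-1}z^{p-1}$ have no common roots. Then its kernel $g(s)=b^\top e^{A_1s_1}\cdots e^{A_ds_d}c\,1_{\{s\ge0\}}$ can be written as $$g(s)=\sum_{\lambda_1}\frac{1}{(\mu_1(\lambda_1)-1)!}\left[\partial_z^{\mu_1(\lambda_1)-1}\Big((z-\lambda_1)^{\mu_1(\lambda_1)}e^{z(s_1+\cdots+s_d)}\frac{b(z)}{a_1(z)}\Big)\right]_{z=\lambda_1}1_{\{s\ge0\}},\quad s\in\mathbb{R}^d,$$ where $\sum_{\lambda_1}$ is the sum over the distinct eigenvalues of $A_1$ and $\mu_1(\lambda_1)$ is the algebraic multiplicity of $\lambda_1$. In particular, if $A_1$ has distinct eigenvalues, then $$g(s)=\sum_{\lambda_1}\frac{b(\lambda_1)}{a_1'(\lambda_1)}e^{\lambda_1(s_1+\cdots+s_d)}1_{\{s\ge0\}},\quad s\in\mathbb{R}^d,$$ where $a_1'(\cdot)$ is the derivative of $a_1(\cdot)$.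
   Context: The companion matrix of a monic polynomial $a(z)=z^p+\alpha_1z^{p-1}+\dots+\alpha_p$ is the $p\times p$ matrix with ones on the superdiagonal, last row $(-\alpha_p,-\alpha_{p-1},\dots,-\alpha_1)$ and zeros elsewhere (for $p=1$: $(-\alpha_1)$). A causal CARMA$(p,q)$ random field on $\mathbb{R}^d$ (integers $0\le q<p$) is given by $$Y(t)=b^\top X(t),\quad X(t)=\int_{-\infty}^{t_1}\cdots\int_{-\infty}^{t_d}e^{A_1(t_1-s_1)}\cdots e^{A_d(t_d-s_d)}c\,\Lambda(ds),\quad t\in\mathbb{R}^d,$$ where $b=(b_0,\dots,b_{p-1})^\top\in\mathbb{R}^p$ with $b_q\neq0$ and $b_i=0$ for $i>q$, $c=(0,\dots,0,1)^\top\in\mathbb{R}^p$, $A_i$ is the companion matrix of a real monic polynomial $a_i$ of degree $p$ whose roots have strictly negative real parts ($i=1,\dots,d$), and $\Lambda$ is a homogeneous Lévy basis on $\mathbb{R}^d$ (an infinitely divisible, independently scattered, stationary random measure) whose Lévy measure $\nu$ satisfies $\int_{\mathbb{R}}\log(|z|)^d1_{\{|z|>1\}}\nu(dz)<\infty$; the integral is a Rajput–Rosiński integral. Equivalently $Y(t)=\int_{\mathbb{R}^d}g(t-s)\Lambda(ds)$ with the kernel $g$ of the claim; the claim itself concerns only this deterministic kernel. Notation: $s\ge0$ is meant componentwise. The bracketed expression at $z=\lambda_1$ is the value after removing the removable singularity at $\lambda_1$. *)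

(* Defs.v *)
From mathcomp Require Import all_boot all_order all_algebra.
From mathcomp Require Import complex.
From mathcomp Require Import all_classical all_reals all_analysis.

Set Implicit Arguments.
Unset Strict Implicit.
Unset Printing Implicit Defensive.

Import Order.TTheory GRing.Theory Num.Theory.
Import numFieldNormedType.Exports.

Local Open Scope classical_set_scope.
Local Open Scope ring_scope.
Local Open Scope complex_scope.

(* The variant of mathcomp's companionmx whose dimension p is given in advance,
   so that polynomials of the same degree p have companion matrices of the same
   type; it is meant for a monic of degree p. *)
Definition companion (R : nzRingType) (p : nat) (a : {poly R}) : 'M[R]_p :=
  \matrix_(i, j) if i.+1 == p then - a`_j else (i.+1 == j :> nat)%:R.

Lemma companionE (R : nzRingType) (a : {poly R}) :
  companion (size a).-1 a = companionmx a.
Proof.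
apply/matrixP => i j; rewrite !mxE; case: i j => i Hi j /=.
by case: (size a) Hi j => [//|[//|n]] Hi j /=; rewrite eqSS.
Qed.

Definition expmx (R : realType) (p : nat) (A : 'M[R]_p) : 'M[R]_p :=
  limn (series (fun k : nat => (k`!%:R)^-1 *: A ^+ k)).

Definition cexp (R : realType) (z : R[i]) : R[i] :=
  (expR (complex.Re z))%:C * (cos (complex.Im z) +i* sin (complex.Im z)).

Definition cpoly (R : realType) (a : {poly R}) : {poly R[i]} :=
  map_poly (real_complex R) a.

(* Row 0 of b is the coefficient b_0. *)
Definition ma_poly (R : realType) (p : nat) (b : 'cV[R]_p) : {poly R} :=
  \sum_(i < p) b i 0 *: 'X^i.

(* The deterministic parameters of a causal CARMA(p, q) field on R^d: a i is the
   autoregressive polynomial of direction i and b the moving average vector.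
   The kernel does not depend on the Levy basis that drives the field. *)
Record causal_carma (R : realType) (d p q : nat)
    (a : 'I_d -> {poly R}) (b : 'cV[R]_p) : Prop := CausalCarma {
  carma_ltqp : (q < p)%N ;
  carma_monic : forall i, a i \is monic ;
  carma_size : forall i, size (a i) = p.+1 ;
  carma_stable : forall i (z : R[i]), root (cpoly (a i)) z -> complex.Re z < 0 ;
  carma_bq : forall k : 'I_p, k = q :> nat -> b k 0 != 0 ;
  carma_b0 : forall k : 'I_p, (q < k)%N -> b k 0 = 0 }.

Definition nonneg_orthant {R : realType} {d : nat} : set 'rV[R]_d :=
  [set s | forall i, 0 <= s 0 i].

(* The product is the non-commutative one of 'M[R]_p, in increasing order
   of i, and (\col_i (i.+1 == p)%:R) is c = (0, ..., 0, 1)^T. *)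
Definition carma_kernel (R : realType) (d p : nat)
    (A : 'I_d -> 'M[R]_p) (b : 'cV[R]_p) (s : 'rV[R]_d) : R :=
  (b^T *m (\prod_(i < d) expmx (s 0 i *: A i))
       *m (\col_i (i.+1 == p)%:R)) 0 0
  * \1_nonneg_orthant s.

Definition ceigenvalues (R : realType) (p : nat) (A : 'M[R]_p) : set R[i] :=
  [set l | eigenvalue (map_mx (real_complex R) A) l].

Definition alg_mult (R : realType) (p : nat) (A : 'M[R]_p) (l : R[i]) : nat :=
  mup l (char_poly (map_mx (real_complex R) A)).

(* The regular module R[i]^o carries the norm topology of the complex numbers. *)
Definition removable_value (R : realType) (f : R[i] -> R[i]) (l : R[i]) : R[i] :=
  lim ((f : R[i]^o -> R[i]^o) z @[z --> (l : R[i]^o)^']).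

Definition cderive (R : realType) (n : nat) (f : R[i] -> R[i]) : R[i] -> R[i] :=
  derive1n n (f : R[i] -> R[i]^o).

(* Main.v *)
Require Import Defs.
From mathcomp Require Import all_boot all_order all_algebra.
From mathcomp Require Import complex ring finmap.
From mathcomp Require Import all_classical all_reals all_analysis.
Import Order.TTheory GRing.Theory Num.Theory.
Import numFieldNormedType.Exports.
Local Open Scope classical_set_scope.
Local Open Scope ring_scope.
Local Open Scope complex_scope.

(** Let [A] be the common companion matrix, [a] its characteristic polynomial,
and [a = (z - l)^mu(l) c_l(z)] at an eigenvalue [l]. By Hermite interpolation a
polynomial is determined modulo [a] by its Taylor coefficients of order less
than [mu(l)] at the eigenvalues. Expanding the powers of [A] accordingly and
summing the exponential series, one gets [e^(sA) = f(A)] for every polynomial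
[f] with the same Taylor coefficients as [e^(sz)]; such polynomials multiply
as exponentials do, so the product of the [e^(s_i A)] is [f(A)] for any [f]
attached to the sum [S] of the [s_i].
On the other hand [b^T f(A) c] is the coefficient of [z^(p-1)] in the remainder
of [b f] modulo [a], which by partial fractions is the sum of the residues of
[b f / a]. A residue depends only on the Taylor coefficients of [f], hence is
that of [b(z) e^(zS) / a(z)]. *)

Set Implicit Arguments.
Unset Strict Implicit.
Unset Printing Implicit Defensive.

(** * Taylor coefficients and partial fractions *)

Section TaylorCoefficients.
Context {F : fieldType}.
Implicit Types (l : F) (f g : {poly F}).

(** Composing with ['X + l%:P] turns Taylor coefficients at [l] into plain coefficients, so the
    Leibniz rule below is just the product formula for coefficients. *)
Lemma coef_comp_XaddC l f j : (f \Po ('X + l%:P))`_j = f^`N(j).[l].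
Proof.
elim/poly_ind: f j => [|f c IH] j.
  by rewrite comp_poly0 coef0 linear0 horner0.
rewrite comp_poly_MXaddC coefD mulrDr coefD coefMX coefMC coefC.
by case: j => [|j]; rewrite ?nderivn0 ?nderivnMXaddC !hornerE /= !IH ?nderivn0.
Qed.

Lemma nderivnM_horner l f g n :
  (f * g)^`N(n).[l] = \sum_(i < n.+1) f^`N(i).[l] * g^`N(n - i).[l].
Proof.
rewrite -coef_comp_XaddC comp_polyM coefM.
by apply: eq_bigr => i _; rewrite !coef_comp_XaddC.
Qed.

Lemma nderivn_expX_horner l k j : ('X^k)^`N(j).[l] = l ^+ (k - j) *+ 'C(k, j).
Proof. by rewrite nderivnXn hornerMn hornerXn. Qed.

Lemma nderivn_expXsubC_horner l i j :
  (('X - l%:P) ^+ i)^`N(j).[l] = (i == j)%:R.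
Proof.
rewrite -coef_comp_XaddC rmorphXn rmorphB /= comp_polyX comp_polyC addrK.
by rewrite coefXn eq_sym.
Qed.

(** After the shift by [l], divisibility by ['X^n] is the vanishing of the first [n] coefficients.
    This translates between jets at [l] and congruences. *)
Lemma dvdp_expXsubCP l f n :
  reflect (forall j, (j < n)%N -> f^`N(j).[l] = 0) (('X - l%:P) ^+ n %| f).
Proof.
apply: (iffP idP) => [/dvdpP[g ->] j ltjn|f0].
  rewrite nderivnM_horner big1// => i _; rewrite nderivn_expXsubC_horner.
  by rewrite gtn_eqF ?mulr0// (leq_ltn_trans (leq_subr _ _) ltjn).
rewrite -[f](comp_polyXaddC_K _ l) -(poly_take_drop n (f \Po _)).
rewrite comp_polyD comp_polyM comp_Xn_poly.
suff -> : take_poly n (f \Po ('X + l%:P)) = 0.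
  by rewrite comp_poly0 add0r dvdp_mull.
apply/polyP => j; rewrite coef_take_poly coef0; case: ifP => // ltjn.
by rewrite coef_comp_XaddC f0.
Qed.

Lemma nderivn_taylor_horner l n (G : nat -> F) j : (j < n)%N ->
  (\sum_(i < n) G i *: ('X - l%:P) ^+ i)^`N(j).[l] = G j.
Proof.
move=> ltjn; rewrite linear_sum horner_sum (bigD1 (Ordinal ltjn))//=.
rewrite linearZ hornerZ nderivn_expXsubC_horner eqxx mulr1 big1 ?addr0// => i.
rewrite -val_eqE /= => /negbTE neij.
by rewrite linearZ hornerZ nderivn_expXsubC_horner neij mulr0.
Qed.

Lemma dvdp_taylor l f n :
  ('X - l%:P) ^+ n %| (\sum_(j < n) f^`N(j).[l] *: ('X - l%:P) ^+ j) - f.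
Proof.
apply/dvdp_expXsubCP => j ltjn.
by rewrite linearB hornerD hornerN (nderivn_taylor_horner l (fun i =>
  f^`N(i).[l]) ltjn) subrr.
Qed.

End TaylorCoefficients.

Definition cofactor_poly {F : fieldType} (rs : seq F) (mu : F -> nat) (l : F) :=
  \prod_(k <- rs | k != l) ('X - k%:P) ^+ mu k.

Section PartialFractions.
Context {F : fieldType}.
Variables (rs : seq F) (mu : F -> nat).
Hypothesis uniq_rs : uniq rs.
Implicit Types (l : F) (f : {poly F}).
Let a := \prod_(l <- rs) ('X - l%:P) ^+ mu l.
Let cof := cofactor_poly rs mu.

Lemma mul_cofactor_poly l : l \in rs -> ('X - l%:P) ^+ mu l * cof l = a.
Proof. by move=> lrs; rewrite /a (bigD1_seq l). Qed.

Lemma cofactor_poly_horner_neq0 l : (cof l).[l] != 0.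
Proof.
rewrite horner_prod prodf_seq_neq0; apply/allP => k _; apply/implyP => nkl.
by rewrite horner_exp expf_neq0// !hornerE subr_eq0 eq_sym.
Qed.

Lemma dvdp_cofactor_poly l k : k \in rs -> k != l ->
  ('X - k%:P) ^+ mu k %| cof l.
Proof.
move=> krs nkl; rewrite /cof /cofactor_poly -big_filter (bigD1_seq k)
  ?filter_uniq//=.
  exact: dvdp_mulr.
by rewrite mem_filter nkl.
Qed.

Lemma dvdp_prod_expXsubC f :
  (forall l, l \in rs -> ('X - l%:P) ^+ mu l %| f) -> a %| f.
Proof.
rewrite /a; elim: rs uniq_rs => [|l s IH] /=; first by rewrite big_nil dvd1p.
move=> /andP[nls us] dvf; rewrite big_cons Gauss_dvdp.
  rewrite dvf ?mem_head// IH// => k ks.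
  by rewrite dvf// inE ks orbT.
apply: coprimep_expl; rewrite coprimep_sym coprimep_XsubC /root horner_prod.
rewrite prodf_seq_neq0; apply/allP => k ks /=.
rewrite horner_exp expf_neq0// !hornerE subr_eq0.
by apply: contraNneq nls => ->.
Qed.

(** Modulo the factor at [l] all cofactors but that of [l] vanish, so each congruence involves a
    single term; coprimality of the factors combines them. *)
Lemma dvdp_sum_cofactor (h : F -> {poly F}) f :
  (forall l, l \in rs -> ('X - l%:P) ^+ mu l %| h l * cof l - f) ->
  a %| (\sum_(l <- rs) h l * cof l) - f.
Proof.
move=> dvh; apply: dvdp_prod_expXsubC => l lrs.
rewrite (bigD1_seq l)//= addrAC dvdp_add ?dvh//.
rewrite big_seq_cond; apply: (big_ind (fun g => _ %| g)); rewrite ?dvdp0//.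
  by move=> ? ?; apply: dvdp_add.
by move=> k /andP[krs nkl]; rewrite dvdp_mull// dvdp_cofactor_poly// eq_sym.
Qed.

(** Bezout: [u l] is a polynomial substitute for the inverse of the cofactor in all jets at [l] of
    order less than [mu l]. *)
Lemma cofactor_poly_inverse : exists u : F -> {poly F},
  forall l, ('X - l%:P) ^+ mu l %| u l * cof l - 1.
Proof.
suff H l : exists v, ('X - l%:P) ^+ mu l %| v * cof l - 1.
  pose P l v := ('X - l%:P) ^+ mu l %| v * cof l - 1.
  by exists (fun l => xchoose (H l)) => l; apply: (xchooseP (H l)).
have /Bezout_eq1_coprimepP[[v w] /= vw] :
    coprimep (cof l) (('X - l%:P) ^+ mu l).
  by rewrite coprimep_expr// coprimep_XsubC cofactor_poly_horner_neq0.
by exists v; rewrite -vw opprD addNKr -mulNr dvdp_mull.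
Qed.

Variable u : F -> {poly F}.
Hypothesis uP : forall l, ('X - l%:P) ^+ mu l %| u l * cof l - 1.

Let dvdp_mul_inverse l f g : ('X - l%:P) ^+ mu l %| g - f ->
  ('X - l%:P) ^+ mu l %| g * u l * cof l - f.
Proof.
move=> dg; have -> : g * u l * cof l - f = g * (u l * cof l - 1) + (g - f).
  by rewrite mulrBr mulr1 mulrA addrA subrK.
by rewrite dvdp_add// dvdp_mull// uP.
Qed.

(** Here the basis is fixed and the coefficients are the jets of [f] alone, which suits passing to
    the limit in a power series. *)
Lemma dvdp_hermite f :
  a %| \sum_(l <- rs) \sum_(j < mu l)
         f^`N(j).[l] *: (('X - l%:P) ^+ j * u l * cof l) - f.
Proof.
under eq_bigr do under eq_bigr do rewrite !scalerAl.
under eq_bigr do rewrite -!big_distrl/=.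
apply: dvdp_sum_cofactor => l lrs.
apply: dvdp_mul_inverse; exact: dvdp_taylor.
Qed.

(** Here [u l] enters the coefficients, which are those of the principal part of [f / a] at [l]; the
    basis has degree less than that of [a], so the sum is the remainder of [f]. *)
Lemma dvdp_partial_fraction f :
  a %| \sum_(l <- rs) \sum_(j < mu l)
         (f * u l)^`N(j).[l] *: (('X - l%:P) ^+ j * cof l) - f.
Proof.
under eq_bigr do under eq_bigr do rewrite !scalerAl.
under eq_bigr do rewrite -!big_distrl/=.
apply: dvdp_sum_cofactor => l lrs.
set T := (X in X * _).
have -> : T * cof l - f = (T - f * u l) * cof l + f * (u l * cof l - 1).
  by rewrite mulrBl mulrBr mulr1 mulrA addrA subrK.
by apply: dvdp_add; [apply/dvdp_mulr/dvdp_taylor | apply/dvdp_mull/uP].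
Qed.

(** The product [u l * cof l] is 1 modulo the factor at [l] and 0 modulo the others, so it glues the
    prescribed Taylor polynomials. *)
Lemma hermite_interpolation (G : F -> nat -> F) :
  exists f : {poly F}, forall l j, l \in rs -> (j < mu l)%N -> f^`N(j).[l] = G
    l j.
Proof.
pose T l := \sum_(j < mu l) G l j *: ('X - l%:P) ^+ j.
exists (\sum_(l <- rs) T l * u l * cof l) => l j lrs ltj.
suff /dvdp_expXsubCP/(_ j ltj) :
    ('X - l%:P) ^+ mu l %| \sum_(l <- rs) T l * u l * cof l - T l.
  move=> /eqP; rewrite linearB hornerD hornerN subr_eq0 => /eqP ->.
  exact: nderivn_taylor_horner.
rewrite (bigD1_seq l)//= addrAC dvdp_add ?dvdp_mul_inverse ?subrr ?dvdp0//.
rewrite big_seq_cond; apply: (big_ind (fun g => _ %| g)); rewrite ?dvdp0//.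
  by move=> ? ?; apply: dvdp_add.
by move=> k /andP[krs nkl]; rewrite dvdp_mull// dvdp_cofactor_poly// eq_sym.
Qed.

End PartialFractions.

(** * Companion matrices *)

Lemma char_poly_companion (R : comNzRingType) p (a : {poly R}) :
  a \is monic -> size a = p.+1 -> char_poly (companion p a) = a.
Proof.
move=> am sa; have -> : p = (size a).-1 by rewrite sa.
by rewrite companionE companionmxK.
Qed.

Lemma horner_companion (F : fieldType) n (a : {poly F}) :
  a \is monic -> size a = n.+2 -> horner_mx (companion n.+1 a) a = 0.
Proof.
by move=> am sa; rewrite -[X in horner_mx _ X](char_poly_companion am sa)
  Cayley_Hamilton.
Qed.

Lemma map_companion (R S : nzRingType) (f : {rmorphism R -> S}) p (a : {poly
  R}) :
  map_mx f (companion p a) = companion p (map_poly f a).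
Proof.
apply/matrixP => i j; rewrite !mxE coef_map.
by case: ifP => _; rewrite ?rmorphN ?rmorph_nat.
Qed.

(** * The functional [b^T f(A) c] as a sum of residues *)

Section CompanionFunctional.
Context {F : fieldType} (n : nat) (a : {poly F}).
Let A := companion n.+1 a.

(** The superdiagonal shifts the basis rows, so the first one is a cyclic vector; the last row of
    the matrix is never met because [k < n.+1]. *)
Lemma delta_mx_companionX k : (k < n.+1)%N ->
  delta_mx 0 0 *m A ^+ k = delta_mx 0 (inord k) :> 'rV_n.+1.
Proof.
elim: k => [|k IH] ltkn.
  by rewrite expr0 mulmx1; congr delta_mx; apply: val_inj; rewrite /= inordK.
rewrite exprSr mulmxA IH 1?ltnW//; apply/rowP => j; rewrite !mxE.
rewrite (bigD1 (inord k))//= big1 => [|i /negbTE nik]; last first.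
  by rewrite !mxE nik andbF mul0r.
rewrite !mxE !eqxx mul1r addr0 /= inordK ?(ltnW ltkn)// ltn_eqF//.
by rewrite -val_eqE /= inordK// eq_sym.
Qed.

Lemma delta_mx_horner_companion (f : {poly F}) : (size f <= n.+1)%N ->
  delta_mx 0 0 *m horner_mx A f = poly_rV f.
Proof.
move=> sf; have {1}-> : f = \sum_(i < n.+1) f`_i *: 'X^i.
  rewrite -poly_def; apply/polyP => i; rewrite coef_poly; case: ltnP => // lni.
  by rewrite nth_default// (leq_trans sf).
rewrite linear_sum mulmx_sumr; apply/rowP => j;
  rewrite !mxE summxE (bigD1 j)//=.
rewrite linearZ /= rmorphXn /= horner_mx_X -scalemxAr delta_mx_companionX//.
rewrite !mxE inord_val !eqxx mulr1 big1 ?addr0// => i /negbTE nij.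
rewrite linearZ /= rmorphXn /= horner_mx_X -scalemxAr delta_mx_companionX//.
by rewrite !mxE inord_val [j == i]eq_sym nij andbF mulr0.
Qed.

Hypotheses (am : a \is monic) (sa : size a = n.+2).

(** By cyclicity [b^T] is the first row of [b(A)], and the column is the last basis vector. *)
Lemma companion_functionalE (b f : {poly F}) : (size b <= n.+1)%N ->
  (poly_rV b *m horner_mx A f *m (\col_i (i.+1 == n.+1)%:R)) 0 0
  = horner_mx A (b * f) 0 ord_max.
Proof.
move=> sb; rewrite -delta_mx_horner_companion// -mulmxA.
rewrite mulmxA; set c := \col_i _.
have -> : c = delta_mx ord_max 0.
  by apply/colP => i; rewrite !mxE eqxx andbT eqSS.
rewrite -colE mxE -mulmxA -rowE mxE.
by rewrite rmorphM.
Qed.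

Variables (rs : seq F) (mu : F -> nat) (u : F -> {poly F}).
Hypothesis uniq_rs : uniq rs.
Hypothesis mu_gt0 : forall l, l \in rs -> (0 < mu l)%N.
Hypothesis aE : a = \prod_(l <- rs) ('X - l%:P) ^+ mu l.
Hypothesis uP :
  forall l, ('X - l%:P) ^+ mu l %| u l * cofactor_poly rs mu l - 1.

Lemma companion_functional (b f : {poly F}) : (size b <= n.+1)%N ->
  (poly_rV b *m horner_mx A f *m (\col_i (i.+1 == n.+1)%:R)) 0 0
  = \sum_(l <- rs) (b * f * u l)^`N((mu l).-1).[l].
Proof.
move=> sb; rewrite companion_functionalE//; set g := b * f.
(* [A] is a root of [a], so [g] may be replaced by its partial fraction expansion. *)
have := dvdp_partial_fraction uniq_rs uP g; rewrite -aE => /dvdpP[w].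
move=> /(congr1 (horner_mx A));
  rewrite rmorphM /= (horner_companion am sa) mulr0.
rewrite rmorphB /= => /eqP; rewrite subr_eq0 => /eqP <-.
rewrite linear_sum summxE !big_seq; apply: eq_bigr => l lrs.
have cofm : cofactor_poly rs mu l \is monic.
  by apply: monic_prod => k _; apply/monic_exp/monicXsubC.
have scof : (size (cofactor_poly rs mu l) + mu l = n.+2)%N.
  rewrite -sa aE -(mul_cofactor_poly mu uniq_rs lrs) size_Mmonic//.
    by rewrite size_exp_XsubC addnC.
  by rewrite -size_poly_eq0 size_exp_XsubC.
have sc0 : (0 < size (cofactor_poly rs mu l))%N
  by rewrite size_poly_gt0 monic_neq0.
have sE j : size (('X - l%:P) ^+ j * cofactor_poly rs mu l)
    = (j + size (cofactor_poly rs mu l))%N.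
  by rewrite size_Mmonic ?size_exp_XsubC// -size_poly_eq0 size_exp_XsubC.
have entry (h : {poly F}) : (size h <= n.+1)%N -> horner_mx A h 0 ord_max =
  h`_n.
  move=> sh; have := delta_mx_horner_companion sh;
    rewrite -rowE => /rowP/(_ ord_max).
  by rewrite !mxE.
(* The basis elements are monic, and only the last index [j] reaches degree [n]; it carries the
   residue at [l]. *)
have coefE j : (j < mu l)%N ->
    (horner_mx A (('X - l%:P) ^+ j * cofactor_poly rs mu l)) 0 ord_max
    = (j == (mu l).-1)%:R.
  move=> ltj; rewrite entry; last by rewrite sE -ltnS -scof addnC ltn_add2l.
  case: eqP => [jE|jN]; last first.
    rewrite nth_default// sE -ltnS.
    have : (j < (mu l).-1)%N
      by rewrite ltn_neqAle -ltnS prednK ?mu_gt0// ltj andbT; apply/eqP.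
    by rewrite -ltnS prednK ?mu_gt0// -(ltn_add2l (size (cofactor_poly rs mu
      l))) scof addnS addnC.
  have /monicP : ('X - l%:P) ^+ j * cofactor_poly rs mu l \is monic.
    by rewrite monicMl// monic_exp// monicXsubC.
  suff -> : n = (size (('X - l%:P) ^+ j * cofactor_poly rs mu l)).-1 by [].
  by rewrite sE jE addnC; case: (mu l) (mu_gt0 lrs) scof => // m _ /=;
    rewrite addnS => -[->].
have lastP : ((mu l).-1 < mu l)%N by rewrite prednK// mu_gt0.
rewrite linear_sum summxE (bigD1 (Ordinal lastP))//= big1 ?addr0 => [|j].
  by rewrite linearZ /= mxE coefE// eqxx mulr1.
rewrite -val_eqE /= => /negbTE nj.
by rewrite linearZ /= mxE coefE// nj mulr0.
Qed.

End CompanionFunctional.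

(** * The complex exponential *)

Definition exp_sum {F : numFieldType} (n : nat) (z : F) : F :=
  \sum_(k < n) z ^+ k / k`!%:R.

Section ExpSum.
Context {F : numFieldType}.
Implicit Types (x y z : F) (n : nat).

(** The binomial theorem, with the terms regrouped over the triangle [i + j < n]. *)
Lemma exp_sumD n x y : exp_sum n (x + y) =
  \sum_(i < n) \sum_(j < n | (i + j < n)%N) (x ^+ j / j`!%:R) * (y ^+ i /
    i`!%:R).
Proof.
pose G j i := (x ^+ j / j`!%:R) * (y ^+ i / i`!%:R).
transitivity (\sum_(k < n) \sum_(i < n | (i <= k)%N) G (k - i)%N i).
  apply: eq_bigr => k _.
  rewrite exprDn big_distrl/= -[RHS](big_ord_widen _ (fun i => G (k - i)%N i)
    (ltn_ord k)).
  apply: eq_bigr => i _; have leik : (i <= k)%N by rewrite -ltnS.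
  rewrite -(bin_fact leik) !natrM /G -mulr_natr.
  have nz m : (m`!)%:R != 0 :> F by rewrite pnatr_eq0 -lt0n fact_gt0.
  have nb : 'C(k, i)%:R != 0 :> F by rewrite pnatr_eq0 -lt0n bin_gt0.
  by rewrite !invfM mulrACA [RHS]mulrACA -[LHS]mulrA mulKf// [i`!%:R^-1 *
    _]mulrC.
rewrite (exchange_big_dep xpredT)//=; apply: eq_bigr => i _.
rewrite -[LHS](big_geq_mkord i n xpredT (fun k => G (k - i)%N i)).
rewrite -{1}[i : nat]add0n big_addn big_mkord.
rewrite (big_ord_widen_cond n xpredT (fun k => G (k + i - i)%N i)) ?leq_subr//.
by apply: eq_big => j; rewrite ?addnK// ltn_subRL.
Qed.

Lemma exp_sumM_sub n x y : exp_sum n x * exp_sum n y - exp_sum n (x + y) =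
  \sum_(i < n) \sum_(j < n | ~~ (i + j < n)%N)
    (x ^+ j / j`!%:R) * (y ^+ i / i`!%:R).
Proof.
rewrite exp_sumD /exp_sum big_distrlr/= exchange_big/= -sumrB.
apply: eq_bigr => i _; rewrite (bigID (fun j : 'I_n => (i + j < n)%N))/=.
by rewrite addrAC subrr add0r.
Qed.

(* The difference is a sum of monomials with nonnegative coefficients, so that
   its norm is bounded by the value at the norms. *)
Lemma norm_exp_sumM_sub n x y :
  `|exp_sum n x * exp_sum n y - exp_sum n (x + y)| <=
  exp_sum n `|x| * exp_sum n `|y| - exp_sum n (`|x| + `|y|).
Proof.
rewrite !exp_sumM_sub; apply: (le_trans (ler_norm_sum _ _ _)).
apply: ler_sum => i _; apply: (le_trans (ler_norm_sum _ _ _)).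
by apply: ler_sum => j _; rewrite !normrM !normfV !normrX !normr_nat.
Qed.

(** The terms of order at least two are compared with those of [exp_sum] through [k! <= (k+2)!]; the
    two last terms on the right are dropped. *)
Lemma norm_exp_sum_sub1 n z :
  `|exp_sum n.+2 z - 1 - z| <= `|z| ^+ 2 * exp_sum n.+2 `|z|.
Proof.
have -> : exp_sum n.+2 z - 1 - z = \sum_(k < n) z ^+ k.+2 / k.+2`!%:R.
  rewrite /exp_sum !big_ord_recl/= expr0 expr1 !divr1 [1 + _]addrC addrK.
  by rewrite [z + _]addrC addrK.
apply: (le_trans (ler_norm_sum _ _ _)).
have geE k : 0 <= `|z| ^+ k / k`!%:R by rewrite divr_ge0 ?exprn_ge0.
rewrite /exp_sum mulr_sumr !big_ord_recr/= -addrA; apply: ler_wpDr.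
  by rewrite addr_ge0// mulr_ge0 ?exprn_ge0.
apply: ler_sum => k _; rewrite normrM normfV normrX normr_nat.
rewrite mulrA -exprD !add2n ler_wpM2l ?exprn_ge0// lef_pV2 ?posrE ?ltr0n
  ?fact_gt0//.
by rewrite ler_nat !factS !mulnA leq_pmull// muln_gt0.
Qed.

End ExpSum.

Section ComplexExponential.
Context {R : realType}.
Local Notation C := (R[i]^o).

Lemma norm_real_complex (x : R) : `|x%:C| = `|x|%:C.
Proof. by rewrite normc_def /= expr0n addr0 sqrtr_sqr. Qed.

Lemma cvg_real_complex T (F : set_system T) {FF : Filter F} (f : T -> R) (x :
  R) :
  f @ F --> x -> (fun t => (f t)%:C : C) @ F --> (x%:C : C).
Proof.
move=> /cvgrPdist_lt fx; apply/cvgrPdist_lt => -[e e'].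
rewrite ltcE /= => /andP[/eqP -> e0].
near=> t; rewrite -rmorphB norm_real_complex ltcR.
by near: t; exact: fx.
Unshelve. all: by end_near. Qed.

Lemma cvg_Re T (F : set_system T) {FF : Filter F} (f : T -> C) (z : C) :
  f @ F --> z -> (fun t => complex.Re (f t)) @ F --> complex.Re z.
Proof.
move=> /cvgrPdist_lt fz; apply/cvgrPdist_lt => e e0.
near=> t; rewrite -ltcR; apply: le_lt_trans (_ : `|z - f t| < _).
  have -> : complex.Re z - complex.Re (f t) = complex.Re (z - f t).
    by case: (z) (f t) => [? ?] [? ?].
  exact: normc_ge_Re.
by near: t; apply: fz; rewrite ltcR.
Unshelve. all: by end_near. Qed.

Lemma cvg_exp_sum_real (x : R) :
  (fun n => exp_sum n x%:C : C) @ \oo --> ((expR x)%:C : C).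
Proof.
have -> : (fun n => exp_sum n x%:C) = (fun n => (series (exp_coeff x) n)%:C).
  apply/funext => n; rewrite /series/= big_mkord rmorph_sum.
  by apply: eq_bigr => k _; rewrite /exp_coeff/= fmorph_div rmorphXn rmorph_nat.
apply: cvg_real_complex; exact: is_cvg_series_exp_coeff.
Qed.

Lemma cvg_exp_sum_imag (y : R) :
  (fun n => exp_sum n (0 +i* y) : C) @ \oo --> (cos y +i* sin y : C).
Proof.
have -> : (fun n => exp_sum n (0 +i* y)) =
    (fun n => (series (cos_coeff y) n)%:C + 'i%C * (series (sin_coeff y) n)%:C).
  apply/funext => n; rewrite /series/= !big_mkord !rmorph_sum mulr_sumr
    -big_split/=.
  apply: eq_bigr => k _; rewrite /cos_coeff /sin_coeff/=.
  have -> : 0 +i* y = 'i%C * y%:C by simpc.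
  rewrite exprMn.
  (* Powers of [i] by parity; for odd [k] the half is written [k.-1./2] to match [sin_coeff]. *)
  have -> : 'i%C ^+ k = ((~~ odd k)%:R * (-1) ^+ k./2)%:C
      + 'i%C * ((odd k)%:R * (-1) ^+ k.-1./2)%:C :> R[i].
    rewrite -{1}(odd_double_half k); case ok: (odd k); last first.
      by rewrite mul0r rmorph0 mulr0 addr0 mul1r add0n -mul2n exprM sqr_i
        rmorphXn rmorphN1.
    rewrite mul0r rmorph0 add0r mul1r -mul2n exprD exprM sqr_i rmorphXn
      rmorphN1 expr1.
    suff -> : k.-1./2 = k./2 by [].
    by rewrite -{1}(odd_double_half k) ok /= doubleK.
  rewrite !rmorphM/= !fmorphV !rmorph_nat !rmorphXn !rmorphN1.
  by rewrite !mulrDl !mulrA.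
rewrite [X in _ --> X](_ : _ = (cos y)%:C + 'i%C * (sin y)%:C); last by simpc.
apply: cvgD; last apply: cvgMl_tmp.
  by apply: cvg_real_complex; rewrite unlock; exact: is_cvg_series_cos_coeff.
by apply: cvg_real_complex; rewrite unlock; exact: is_cvg_series_sin_coeff.
Qed.

Lemma cexpD (z w : R[i]) : cexp (z + w) = cexp z * cexp w.
Proof.
case: z w => [x y] [x' y']; rewrite /cexp /= expRD cosD sinD; simpc.
by congr (_ +i* _); ring.
Qed.

Lemma cexp0 : cexp (0 : R[i]) = 1.
Proof. by rewrite /cexp /= expR0 cos0 sin0 mul1r. Qed.

(** The product of the partial sums at the real and imaginary parts converges to [cexp]. It remains
    to see that its difference with the partial sum at [z] tends to 0. *)
Lemma cvg_exp_sum (z : R[i]) : (fun n => exp_sum n z : C) @ \oo --> (cexp z :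
  C).
Proof.
case: z => x y; set X := x%:C; set Y : R[i] := 0 +i* y.
have zE : x +i* y = X + Y by rewrite /X /Y; simpc.
have cM : (fun n => exp_sum n X * exp_sum n Y : C) @ \oo --> (cexp (x +i* y) :
  C).
  rewrite /cexp /=; apply: cvgM; first exact: cvg_exp_sum_real.
  exact: cvg_exp_sum_imag.
have NE (w : R[i]) : exists r : R, `|w| = r%:C.
  by exists (complex.Re `|w|); rewrite RRe_real// ger0_real.
have [a aE] := NE X; have [b bE] := NE Y.
(* At the norms, which are real, the difference vanishes in the limit by [expRD]; it dominates the
   complex one. *)
have c0 : (fun n => exp_sum n a%:C * exp_sum n b%:C - exp_sum n (a%:C + b%:C) :
  C)
    @ \oo --> (0 : C).
  rewrite [X in _ --> X](_ : _ = (expR a)%:C * (expR b)%:C - (expR (a + b))%:C).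
    apply: cvgB; last by rewrite -rmorphD; exact: cvg_exp_sum_real.
    by apply: cvgM; exact: cvg_exp_sum_real.
  by rewrite expRD rmorphM subrr.
have c1 : (fun n => exp_sum n X * exp_sum n Y - exp_sum n (X + Y) : C) @ \oo
  --> (0 : C).
  apply/cvgr0Pnorm_lt => e e0; move/cvgr0Pnorm_lt/(_ e e0): c0.
  apply: filterS => n; have := norm_exp_sumM_sub n X Y; rewrite aE bE => le_ab.
  by apply: le_lt_trans; rewrite [leRHS]ger0_norm// (le_trans _ le_ab).
rewrite zE in cM *.
have -> : (fun n => exp_sum n (X + Y)) = (fun n => exp_sum n X * exp_sum n Y
    - (exp_sum n X * exp_sum n Y - exp_sum n (X + Y))).
  by apply/funext => n; rewrite subKr.
rewrite [X in _ --> X](_ : _ = cexp (X + Y) - 0); last by rewrite subr0.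
by apply: cvgB; [exact: cM | exact: c1].
Qed.

End ComplexExponential.

(** * Complex derivatives of polynomials and of the exponential *)

Lemma is_derive_horner (F : numFieldType) (p : {poly F}) (x : F^o) :
  is_derive x (1 : F^o) (fun z : F^o => p.[z] : F^o) p^`().[x].
Proof.
elim/poly_ind: p => [|p c IH].
  rewrite (_ : (fun _ => _) = cst 0) ?deriv0 ?horner0; last first.
    by apply/funext => z; rewrite horner0.
  exact: is_derive_cst.
rewrite (_ : (fun _ => _) = (fun z : F^o => p.[z] : F^o) * id + cst c);
  last first.
  by apply/funext => z; rewrite hornerMXaddC.
have d := is_deriveD (is_deriveM IH (is_derive_id x 1)) (is_derive_cst (c :
  F^o) x 1).
apply: (is_derive_eq d);
  rewrite derivMXaddC hornerD hornerMX addr0 /GRing.scale/=.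
by rewrite mulr1 [x * _]mulrC.
Qed.

Lemma continuous_horner_numField (F : numFieldType) (p : {poly F}) :
  continuous (fun z : F^o => p.[z] : F^o).
Proof.
move=> x; apply/differentiable_continuous/derivable1_diffP.
by have [] := is_derive_horner p x.
Qed.

Section ComplexExponentialDerivative.
Context {R : realType}.
Local Notation C := (R[i]^o).

Let exp_sum_shift (z : R[i]) :
  (fun n => exp_sum n.+2 z : C) @ \oo --> (cexp z : C).
Proof.
rewrite (_ : (fun n => _) = (fun n => exp_sum n z : C) \o addn^~ 2).
  by apply: cvg_comp (cvg_addnr 2) _; exact: cvg_exp_sum.
by apply/funext => n; rewrite /= addn2.
Qed.

Lemma cexp_real (x : R) : cexp x%:C = (expR x)%:C.
Proof. by rewrite /cexp /= cos0 sin0 mulr1. Qed.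

Lemma cexp_sub1_le (h : R[i]) :
  `|cexp h - 1 - h| <= `|h| ^+ 2 * (expR (complex.Re `|h|))%:C.
Proof.
have nE (w : R[i]) : `|w| = (complex.Re `|w|)%:C
  by rewrite RRe_real// ger0_real.
have r0 (w : R[i]) : 0 <= w -> w = (complex.Re w)%:C.
  by move=> w0; rewrite RRe_real// ger0_real.
rewrite (r0 `|_ - _ - _|)// [leRHS]r0; last first.
  by rewrite mulr_ge0 ?exprn_ge0// ler0c expR_ge0.
rewrite lecR.
pose u n : C := `|exp_sum n.+2 h - 1 - h|.
pose v n : C := `|h| ^+ 2 * exp_sum n.+2 `|h|.
have cu : u @ \oo --> (`|cexp h - 1 - h| : C).
  have c : (fun n => exp_sum n.+2 h - 1 - h : C) @ \oo --> (cexp h - 1 - h : C).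
    have c' : (fun n => exp_sum n.+2 h - 1 : C) @ \oo --> (cexp h - 1 : C).
      exact: (cvgB (@exp_sum_shift h) (cvg_cst (1 : C))).
     exact: (cvgB c' (cvg_cst (h : C))).
  exact: (cvg_norm c).
have cv : v @ \oo --> (`|h| ^+ 2 * (expR (complex.Re `|h|))%:C : C).
  by apply: cvgMl_tmp; rewrite -cexp_real -nE; exact: exp_sum_shift.
apply: ler_cvg_to (cvg_Re cu) (cvg_Re cv) _.
apply: nearW => n; rewrite -lecR -!r0//; first exact: norm_exp_sum_sub1.
  by apply: le_trans (norm_exp_sum_sub1 n h).
exact: normr_ge0.
Qed.

(** By [cexpD] the error of the difference quotient is [cexp (z * s) / h] times
    [cexp (h * s) - 1 - h * s], which is quadratic in [h]; so it is at most [K * |h|] when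
    [|h| < 1]. *)
Lemma is_derive_cexp (s : R[i]) (z : C) :
  is_derive z (1 : C) (fun w : C => cexp (w * s) : C) (s * cexp (z * s)).
Proof.
suff d : (fun h : C => h^-1 *: (cexp ((h *: (1 : C) + z) * s) - cexp (z * s)) :
  C)
    @ 0^' --> (s * cexp (z * s) : C).
  by apply: DeriveDef; [apply/cvg_ex; eexists; exact: d | exact: (cvg_lim _ d)].
pose K := `|cexp (z * s)| * `|s| ^+ 2 * (expR (complex.Re `|s|))%:C.
have K0 : 0 <= K by rewrite !mulr_ge0 ?exprn_ge0// ler0c expR_ge0.
apply/cvgrPdistC_lt => e e0; near=> h.
have h0 : h != 0 by near: h; exact: nbhs_dnbhs_neq.
have h1 : `|h| < 1.
  by near: h; exact: dnbhs0_lt.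
(* The denominator is [K + 1] since [K] may be zero. *)
have hK : `|h| < e / (K + 1).
  by near: h; apply: dnbhs0_lt; rewrite divr_gt0// ltr_wpDl.
rewrite /GRing.scale/= mulr1 mulrDl cexpD.
have -> : h^-1 * (cexp (h * s) * cexp (z * s) - cexp (z * s)) - s * cexp (z * s)
    = cexp (z * s) * h^-1 * (cexp (h * s) - 1 - h * s) by field.
rewrite normrM [ `|cexp _ * _|]normrM normfV.
apply: (@le_lt_trans _ _ (K * `|h|)); last first.
  apply: (@le_lt_trans _ _ ((K + 1) * `|h|));
    first by rewrite ler_wpM2r// lerDl.
  by rewrite mulrC -ltr_pdivlMr// ltr_wpDl.
apply: (@le_trans _ _ (`|cexp (z * s)| * `|h|^-1 *
    (`|h * s| ^+ 2 * (expR (complex.Re `|s|))%:C))).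
  rewrite ler_wpM2l ?mulr_ge0 ?invr_ge0//; apply: (le_trans (cexp_sub1_le _)).
  rewrite ler_wpM2l ?exprn_ge0// lecR ler_expR -lecR !RRe_real ?ger0_real//.
  by rewrite normrM ler_piMl// ltW.
rewrite [ `|h * s|]normrM exprMn /K le_eqVlt; apply/orP; left; apply/eqP.
have nh0 : `|h| != 0 by rewrite normr_eq0.
by move: (`|h|) nh0 => r r0; field.
Unshelve. all: by end_near. Qed.

End ComplexExponentialDerivative.

(** * Residues *)

Lemma nderivn_deriv_horner (F : fieldType) (l : F) (f : {poly F}) i :
  (f^`()%R)^`N(i).[l] = f^`N(i.+1).[l] *+ i.+1.
Proof.
rewrite -!coef_comp_XaddC -coef_deriv deriv_comp derivD derivX derivC addr0.
by rewrite mulr1.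
Qed.

Lemma dvdp_expXsubC_deriv (F : fieldType) (l : F) (f : {poly F}) n :
  ('X - l%:P) ^+ n.+1 %| f -> ('X - l%:P) ^+ n %| f^`()%R.
Proof.
move=> /dvdp_expXsubCP f0; apply/dvdp_expXsubCP => j ltjn.
by rewrite nderivn_deriv_horner f0 ?mul0rn.
Qed.

(* The derivative of [e^(sz) Q(z)] is [e^(sz) (exp_deriv s Q)(z)]. *)
Definition exp_deriv {F : fieldType} (s : F) (Q : {poly F}) : {poly F} :=
  s *: Q + Q^`()%R.

(** The Leibniz rule for [e^(sz) Q(z)], with the exponential factored out. *)
Lemma iter_exp_deriv_horner (F : numFieldType) (s l : F) (Q : {poly F}) n :
  (iter n (exp_deriv s) Q).[l] =
  n`!%:R * \sum_(j < n.+1) s ^+ j / j`!%:R * Q^`N(n - j).[l].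
Proof.
elim: n Q => [|n IH] Q.
  by rewrite big_ord1 /= expr0 subnn nderivn0 divr1 !mul1r.
rewrite iterSr IH factS natrM [n.+1%:R * _]mulrC -mulrA; congr (_ * _).
pose t j := s ^+ j / j`!%:R * Q^`N(n.+1 - j).[l].
rewrite mulr_sumr.
(* The factor [n+1] is split as [j + (n+1-j)]: the first part comes from [s *: Q], the second from
   the derivative of [Q]. *)
transitivity (\sum_(j < n.+2) j%:R * t j + \sum_(j < n.+2) (n.+1 - j)%:R * t j).
  rewrite [X in X + _]big_ord_recl mul0r add0r.
  rewrite [X in _ + X]big_ord_recr/= subnn mul0r addr0 -big_split/=.
  apply: eq_bigr => j _; rewrite /exp_deriv linearD linearZ/= hornerD hornerZ.
  rewrite nderivn_deriv_horner mulrDr; congr (_ + _).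
    rewrite /t /bump/= add1n subSS factS natrM exprS.
    have n0 : j`!%:R != 0 :> F by rewrite pnatr_eq0 -lt0n fact_gt0.
    have n1 : j.+1%:R != 0 :> F by rewrite pnatr_eq0.
    by move: (j.+1%:R) n1 (j`!%:R) n0 => x x0 y y0; field; rewrite ?x0 ?y0.
  have lejn : (j <= n)%N by rewrite -ltnS.
  by rewrite /t subSn// [RHS]mulrCA mulr_natl.
rewrite -big_split; apply: eq_bigr => j _.
by rewrite /= -mulrDl -natrD subnKC// -ltnS.
Qed.

Section Residue.
Context {R : realType}.
Local Notation C := (R[i]^o).
Variables (s l : R[i]) (m : nat) (a b c u : {poly R[i]}).
Hypotheses (m_gt0 : (0 < m)%N) (aE : a = ('X - l%:P) ^+ m * c).
Hypotheses (cl : c.[l] != 0) (uP : ('X - l%:P) ^+ m %| u * c - 1).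

(* Near [l] the function [(z - l)^m b / a] is [b / c = b u + b (1 - u c) / c],
   where [(z - l)^m] divides the numerator of the last term: that term does not
   contribute to the derivatives of order less than [m] at [l]. *)
Let Q n := iter n (exp_deriv s) (b * u).
(** The [n]th derivative of [e^(sz) P 0 / c] is [e^(sz) P n / c^(n+1)]: the recursion is the
    quotient rule. *)
Let P := fix P n : {poly R[i]} :=
  if n is n'.+1 then exp_deriv s (P n') * c - n'.+1%:R *: (P n' * c^`()%R)
  else b * (1 - u * c).
Let G n (z : C) : C :=
  cexp (z * s) * ((Q n).[z] + (P n).[z] / c.[z] ^+ n.+1).

(** Each step differentiates once and loses at most one factor ['X - l%:P]. *)
Let dvdp_P n : (n <= m)%N -> ('X - l%:P) ^+ (m - n) %| P n.
Proof.
elim: n => [|n IH] lenm /=.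
  by rewrite subn0; apply: dvdp_mull; rewrite -(opprB _ 1) dvdpNr.
have dP : ('X - l%:P) ^+ (m - n.+1).+1 %| P n.
    by rewrite subnSK//; apply/IH/ltnW.
have dP' : ('X - l%:P) ^+ (m - n.+1) %| P n.
  by apply: dvdp_trans dP; rewrite dvdp_exp2l.
apply: dvdp_sub; last by rewrite -mul_polyC dvdp_mull// dvdp_mulr.
apply/dvdp_mulr/dvdp_add; first by rewrite -mul_polyC dvdp_mull.
exact: dvdp_expXsubC_deriv.
Qed.

(** Only the zeros of [c] are excluded, so this also holds at [l], where [a] vanishes. *)
Let is_derive_G n (z : C) : c.[z] != 0 -> is_derive z (1 : C) (G n) (G n.+1 z).
Proof.
move=> cz.
have dV : is_derive z (1 : C) (fun w : C => (c.[w] ^+ n.+1)^-1 : C)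
    (- (c.[z] ^+ n.+1) ^- 2 *: ((n.+1%:R * c.[z] ^+ n) *: (c^`()%R).[z])).
  have [d1 d2] := is_deriveX n.+1 (is_derive_horner c z).
  have cz' : ((fun w : C => c.[w] : C) ^+ n.+1) z != 0
    by rewrite exprfctE expf_neq0.
  by apply: DeriveDef; [have := derivableV cz' d1 | have := deriveV cz' d1;
    rewrite d2];
    rewrite exprfctE.
have dG := is_deriveM (is_derive_cexp s z)
  (is_deriveD (is_derive_horner (Q n) z) (is_deriveM (is_derive_horner (P n) z)
    dV)).
apply: (is_derive_eq dG).
set E := (X in _ + X *: _ = _).
have -> : E = (Q n).[z] + (P n).[z] / c.[z] ^+ n.+1 by [].
have QE : (Q n.+1).[z] = s * (Q n).[z] + (Q n)^`()%R.[z].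
  by rewrite /Q iterS /exp_deriv hornerD hornerZ.
have PE : (P n.+1).[z] = (s * (P n).[z] + (P n)^`()%R.[z]) * c.[z]
    - n.+1%:R * ((P n).[z] * c^`()%R.[z]).
  by rewrite /= /exp_deriv hornerD hornerN !hornerZ !hornerM hornerD hornerZ.
rewrite /G QE PE /GRing.scale /= !exprS.
have : c.[z] ^+ n != 0 by rewrite expf_neq0.
move: (c.[z] ^+ n) c.[z] cz c^`()%R.[z] (cexp _) (P n).[z] (P n)^`()%R.[z].
move=> {QE PE E dG dV} X y y0 y' e p p' X0.
by field; rewrite y0 X0.
Qed.

(** Off the zeros of [a] the function is [G 0] and its derivatives are the [G n]; these are
    continuous at [l], so the limit is the value there. *)
Lemma cderive_removable_value :
  removable_value (cderive m.-1 (fun z : R[i] =>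
    (z - l) ^+ m * cexp (z * s) * (b.[z] / a.[z]))) l =
  m.-1`!%:R * \sum_(j < m)
    s ^+ j / j`!%:R * cexp (l * s) * (b * u)^`N(m.-1 - j).[l].
Proof.
set f := (fun z : R[i] => _).
have aN0 (z : C) : a.[z] != 0 -> (\forall w \near z, a.[w] != 0).
  by move=> az; apply: (cvgr_neq0 _ (@continuous_horner_numField _ a z)).
have derE n (z : C) : a.[z] != 0 -> cderive n f z = G n z.
  elim: n z => [|n IH] z az.
    move: (az); rewrite aE hornerM mulf_eq0 negb_or => /andP[lz cz].
    rewrite /G /cderive derive1n0 /f aE hornerM expr1 /Q /= !hornerM.
    rewrite hornerD hornerN hornerM hornerC.
    move: lz; rewrite horner_exp hornerXsubC.
    move: ((z - l) ^+ m) (cexp _) u.[z] b.[z] c.[z] cz => X e v y w w0 X0.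
    by field; rewrite w0 X0.
  have dG : is_derive z (1 : C) (G n) (G n.+1 z).
    by apply: is_derive_G; move: az;
      rewrite aE hornerM mulf_eq0 negb_or => /andP[].
  rewrite /cderive derive1nS derive1E.
  rewrite (near_eq_derive _ (g := G n)); first by have [_ ->] := dG.
  by near=> w; apply: IH; near: w; exact: aN0.
have Gc : G m.-1 z @[z --> (l : C)] --> G m.-1 l.
  apply: differentiable_continuous; apply/derivable1_diffP.
  by have [] := is_derive_G m.-1 cl.
rewrite /removable_value.
transitivity (G m.-1 l).
  apply: (@cvg_lim C); first exact: norm_hausdorff.
  have : G m.-1 z @[z --> (l : C)^'] --> G m.-1 l by exact: cvg_within_filter.
  apply: cvg_trans; apply: near_eq_cvg; near=> z; rewrite derE//.
  rewrite aE hornerM mulf_neq0//.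
    rewrite horner_exp hornerXsubC expf_neq0// subr_eq0.
    by near: z; exact: nbhs_dnbhs_neq.
  near: z; apply: nbhs_dnbhs.
  exact: (cvgr_neq0 _ (@continuous_horner_numField _ c l)).
(* At order [m - 1] one factor ['X - l%:P] is left in [P]. *)
rewrite /G; have -> : (P m.-1).[l] = 0.
  apply/eqP; rewrite -/(root _ _) -dvdp_XsubCl.
  by have := dvdp_P (leq_pred m);
    rewrite -[X in (X - _)%N](prednK m_gt0) subSnn expr1.
rewrite mul0r addr0 /Q iter_exp_deriv_horner mulrCA; congr (_ * _).
rewrite prednK// mulr_sumr; apply: eq_bigr => j _.
by rewrite mulrA [cexp _ * _]mulrC.
Unshelve. all: by end_near. Qed.

End Residue.

(** * Matrix exponentials *)

Lemma cvg_mx (R : realType) (T : Type) (F : set_system T) {FF : Filter F} p q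
    (M : T -> 'M[R]_(p, q)) (N : 'M[R]_(p, q)) :
  (forall i j, M t i j @[t --> F] --> N i j) -> M @ F --> N.
Proof.
move=> cM; apply/cvg_ballP => e e0; near=> t; split => // i j; move: i j.
near: t; apply: filter_forall => i; apply: filter_forall => j.
by have /cvg_ballP/(_ e e0) := cM i j.
Unshelve. all: by end_near. Qed.

Section MatrixExponential.
Context {R : realType}.
Local Notation C := (R[i]^o).
Variables (rs : seq R[i]) (mu : R[i] -> nat).
Hypothesis uniq_rs : uniq rs.

(* [f] has the same Taylor coefficients as [e^(sz)] at the points of [rs], up to
   the order given by [mu]. *)
Definition exp_jet (s : R[i]) (f : {poly R[i]}) := forall l j, l \in rs ->
  (j < mu l)%N -> f^`N(j).[l] = s ^+ j / j`!%:R * cexp (l * s).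

Lemma exp_jet0 : exp_jet 0 1.
Proof.
move=> l j _ _; rewrite mulr0 cexp0 mulr1 -polyC1 nderivnC.
by case: j => [|j]; rewrite ?hornerC ?expr0 ?divr1 ?expr0n ?mul0r ?horner0 /=. 
Qed.

Lemma exp_jetM s t f g : exp_jet s f -> exp_jet t g -> exp_jet (s + t) (f * g).
Proof.
move=> jf jg l j lrs ltj; rewrite nderivnM_horner mulrDr cexpD addrC exprDn.
rewrite !mulr_suml; apply: eq_bigr => i _;
  have leij : (i <= j)%N by rewrite -ltnS.
rewrite jf ?jg//; [|exact: leq_ltn_trans (leq_subr _ _) ltj|exact:
  leq_ltn_trans ltj].
rewrite -[in RHS]mulr_natr -(bin_fact leij) !natrM.
have nz k : (k`!)%:R != 0 :> R[i] by rewrite pnatr_eq0 -lt0n fact_gt0.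
have nb : 'C(j, i)%:R != 0 :> R[i] by rewrite pnatr_eq0 -lt0n bin_gt0.
move: 'C(j, i)%:R i`!%:R (j - i)`!%:R nb (nz i) (nz (j - i)%N) => x y z x0 y0
  z0.
move: (cexp (l * s)) (cexp (l * t)) => e e'.
by field; rewrite ?x0 ?y0 ?z0.
Qed.

Lemma exp_jet_prod (I : Type) (r : seq I) (s : I -> R[i]) (f : I -> {poly
  R[i]}) :
  (forall i, exp_jet (s i) (f i)) -> exp_jet (\sum_(i <- r) s i) (\prod_(i <-
    r) f i).
Proof.
move=> jf; apply: (big_ind2 (fun s f => exp_jet s f)) => //.
  exact: exp_jet0.
by move=> ? ? ? ?; apply: exp_jetM.
Qed.

(** The powers below [j] contribute nothing; for the others [C(k, j) / k! = 1 / (j! (k-j)!)] leaves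
    the exponential series at [l * s]. *)
Lemma cvg_exp_jet_coef (s l : R[i]) j :
  (fun N => \sum_(k < N) s ^+ k / k`!%:R * ('X^k)^`N(j).[l] : C) @ \oo
  --> (s ^+ j / j`!%:R * cexp (l * s) : C).
Proof.
rewrite -(cvg_shiftn j).
rewrite (_ : [sequence _]_n = (fun n => s ^+ j / j`!%:R * exp_sum n (l * s) :
  C)).
  by apply: cvgMl_tmp; exact: cvg_exp_sum.
apply/funext => n /=; rewrite addnC big_split_ord/= big1 ?add0r => [|i _];
  last first.
  by rewrite nderivn_expX_horner bin_small// mulr0n mulr0.
rewrite mulr_sumr; apply: eq_bigr => i _.
rewrite nderivn_expX_horner addKn -[_ *+ 'C(_, _)]mulr_natr -(bin_fact
  (leq_addr i j)) addKn exprD exprMn.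
have nz k : (k`!)%:R != 0 :> R[i] by rewrite pnatr_eq0 -lt0n fact_gt0.
have nb : 'C(j + i, j)%:R != 0 :> R[i]
  by rewrite pnatr_eq0 -lt0n bin_gt0 leq_addr.
rewrite !natrM.
move: 'C(j + i, j)%:R i`!%:R j`!%:R nb (nz i) (nz j) => x y z x0 y0 z0.
by field; rewrite ?x0 ?y0 ?z0.
Qed.

Variables (n : nat) (A : 'M[R]_n.+1) (u : R[i] -> {poly R[i]}).
Let AC := map_mx (real_complex R) A.
Hypothesis uP :
  forall l, ('X - l%:P) ^+ mu l %| u l * cofactor_poly rs mu l - 1.
Hypothesis A_root : horner_mx AC (\prod_(l <- rs) ('X - l%:P) ^+ mu l) = 0.

Let E l j := horner_mx AC (('X - l%:P) ^+ j * u l * cofactor_poly rs mu l).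

Let horner_mx_hermite f :
  horner_mx AC f = \sum_(l <- rs) \sum_(j < mu l) f^`N(j).[l] *: E l j.
Proof.
have /dvdpP[w] := dvdp_hermite uniq_rs uP f.
move=> /(congr1 (horner_mx AC)); rewrite rmorphM /= A_root mulr0.
rewrite rmorphB /= => /eqP; rewrite subr_eq0 => /eqP <-.
rewrite linear_sum; apply: eq_bigr => l _.
by rewrite linear_sum; apply: eq_bigr => j _; rewrite linearZ.
Qed.

(** Expanding the powers of [A] in the fixed matrices [E l j] reduces the matrix series to finitely
    many scalar series, whose sums are the jets of [f]. *)
Lemma map_expmx (s : R) (f : {poly R[i]}) : exp_jet s%:C f ->
  map_mx (real_complex R) (expmx (s *: A)) = horner_mx AC f.
Proof.
move=> jf; set H := horner_mx AC f.
pose S N := series (fun k : nat => (k`!%:R)^-1 *: (s *: A) ^+ k) N.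
have cS x y : (fun N => (S N x y)%:C : C) @ \oo --> (H x y : C).
  have -> : H x y = \sum_(l <- rs) \sum_(j < mu l)
      (s%:C ^+ j / j`!%:R * cexp (l * s%:C)) * E l j x y.
    rewrite /H horner_mx_hermite summxE !big_seq; apply: eq_bigr => l lrs.
    by rewrite summxE; apply: eq_bigr => j _; rewrite mxE jf.
  have -> : (fun N => (S N x y)%:C) = (fun N => \sum_(l <- rs) \sum_(j < mu l)
      (\sum_(k < N) s%:C ^+ k / k`!%:R * ('X^k)^`N(j).[l]) * E l j x y).
    apply/funext => N; rewrite /S /series /= big_mkord summxE rmorph_sum/=.
    transitivity (\sum_(k < N) \sum_(l <- rs) \sum_(j < mu l)
        s%:C ^+ k / k`!%:R * ('X^k)^`N(j).[l] * E l j x y).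
      apply: eq_bigr => k _.
      rewrite exprZn !mxE !rmorphM/= fmorphV rmorph_nat rmorphXn/=.
      have -> : ((A ^+ k) x y)%:C = (horner_mx AC 'X^k) x y.
        by rewrite rmorphXn/= horner_mx_X -rmorphXn mxE.
      rewrite horner_mx_hermite summxE mulrA mulr_sumr; apply: eq_bigr => l _.
      rewrite summxE mulr_sumr; apply: eq_bigr => j _.
      by rewrite mxE mulrA [_^-1 * _]mulrC.
    rewrite exchange_big; apply: eq_bigr => l _.
    by rewrite exchange_big; apply: eq_bigr => j _; rewrite mulr_suml.
  apply: (cvg_big (U := C) (op := +%R) add_continuous) => l _.
  apply: (cvg_big (U := C) (op := +%R) add_continuous) => j _.
  by apply: cvgMr_tmp; exact: cvg_exp_jet_coef.
(* [H] is a limit of real matrices, hence real; this identifies [expmx], which is a limit over the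
   reals. *)
have cR x y : (fun N => S N x y) @ \oo --> complex.Re (H x y) := cvg_Re (cS x
  y).
have HR x y : H x y = (complex.Re (H x y))%:C.
  have cRC : (fun N => (S N x y)%:C : C) @ \oo --> ((complex.Re (H x y))%:C :
    C).
    by apply: cvg_real_complex; exact: cR.
  exact: (cvg_unique (@norm_hausdorff _ C) (cS x y) cRC).
have -> : expmx (s *: A) = \matrix_(x, y) complex.Re (H x y).
  apply: cvg_lim; first exact: norm_hausdorff.
  by apply: cvg_mx => x y; rewrite mxE; exact: cR.
by apply/matrixP => x y; rewrite !mxE -HR.
Qed.

End MatrixExponential.

(** * The kernel *)

(** The list [rs] is the list of roots without repetitions. In the last clause [size a] is the
    degree plus one, so nothing was repeated. *)
Lemma closed_field_factorization (F : closedFieldType) (a : {poly F}) :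
  a \is monic -> exists rs : seq F, [/\ uniq rs, forall l, (l \in rs) = root a
    l,
    a = \prod_(l <- rs) ('X - l%:P) ^+ mup l a
    & (size rs).+1 = size a -> forall l, l \in rs -> mup l a = 1%N].
Proof.
move=> am; have [r] := closed_field_poly_normal a;
  rewrite (monicP am) scale1r => aE.
have a0 : a != 0 by exact: monic_neq0.
have mupE l : mup l a = count_mem l r.
  rewrite aE; elim: r {aE} => [|z r IH] /=.
    by rewrite big_nil mupNroot// rootC oner_eq0.
  have X0 : 'X - z%:P != 0 by rewrite polyXsubC_eq0.
  rewrite big_cons mupM ?IH//; last first.
    by rewrite prodf_seq_neq0; apply/allP => w _; rewrite polyXsubC_eq0.
  by rewrite -[X in mup l X]expr1 mup_XsubCX; case: (z == l).
exists (undup r); split; first exact: undup_uniq.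
- by move=> l; rewrite mem_undup aE root_prod_XsubC.
- rewrite {1}aE -prodr_undup_exp_count.
  by apply: eq_bigr => l _; rewrite mupE.
- rewrite {1}aE size_prod_XsubC => -[szr] l; rewrite mem_undup => lr.
  have ur : uniq r by rewrite -[uniq r]negbK -ltn_size_undup szr ltnn.
  by rewrite mupE count_uniq_mem// lr.
Qed.

Lemma card_set_seqE (T : choiceType) (s : seq T) k :
  uniq s -> ([set` s] #= `I_k)%card -> size s = k.
Proof.
move=> us; have -> : [set` s] = [set` [fset x in s]%fset].
  by apply/seteqP; split => x /=; rewrite inE.
by move=> /card_eq_fsetP <-; rewrite card_fseq undup_id.
Qed.

Section CarmaFunctional.
Context {R : realType} (n : nat) (a : {poly R}).
Hypotheses (am : a \is monic) (sa : size a = n.+2).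
Let ac := cpoly a.
Variables (rs : seq R[i]) (u : R[i] -> {poly R[i]}).
Let mu l := mup l ac.
Hypotheses (uniq_rs : uniq rs) (rsE : forall l, (l \in rs) = root ac l).
Hypothesis acE : ac = \prod_(l <- rs) ('X - l%:P) ^+ mu l.
Hypothesis uP :
  forall l, ('X - l%:P) ^+ mu l %| u l * cofactor_poly rs mu l - 1.

(** Each direction gets an interpolating polynomial [f i]. The exponentials being polynomials in one
    matrix, their product is the value there of the product of the [f i], which interpolates the
    exponential of the sum. *)
Lemma carma_functional d (b : 'cV[R]_n.+1) (s : 'I_d -> R) :
  ((b^T *m (\prod_(i < d) expmx (s i *: companion n.+1 a))
       *m (\col_i (i.+1 == n.+1)%:R)) 0 0)%:C =
  \sum_(l <- rs) \sum_(j < mu l)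
    (\sum_(i < d) s i)%:C ^+ j / j`!%:R * cexp (l * (\sum_(i < d) s i)%:C)
    * (cpoly (ma_poly b) * u l)^`N((mu l).-1 - j).[l].
Proof.
have acm : ac \is monic by rewrite map_monic.
have sac : size ac = n.+2 by rewrite size_map_poly.
set S := \sum_(i < d) s i; set A := companion _ _; set bc := cpoly _.
have AE : map_mx (real_complex R) A = companion n.+1 ac
  by rewrite map_companion.
have mu_gt0 l : l \in rs -> (0 < mu l)%N.
  by rewrite rsE -dvdp_XsubCl XsubC_dvd ?monic_neq0.
have /choice[f jf] : forall i, exists f, exp_jet rs mu (s i)%:C f.
  move=> i; have [f fE] := hermite_interpolation uniq_rs uP
    (fun l j => (s i)%:C ^+ j / j`!%:R * cexp (l * (s i)%:C)).
  by exists f.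
have jS : exp_jet rs mu S%:C (\prod_(i < d) f i).
  by rewrite rmorph_sum; exact: exp_jet_prod.
have A_root : horner_mx (map_mx (real_complex R) A)
    (\prod_(l <- rs) ('X - l%:P) ^+ mu l) = 0.
  by rewrite -acE AE horner_companion.
have prodE : map_mx (real_complex R) (\prod_(i < d) expmx (s i *: A))
    = horner_mx (companion n.+1 ac) (\prod_(i < d) f i).
  rewrite !rmorph_prod; apply: eq_bigr => i _.
  by rewrite -AE; apply: (map_expmx uniq_rs uP A_root).
have bE : map_mx (real_complex R) b^T = poly_rV bc.
  apply/rowP => i; rewrite !mxE coef_map /ma_poly coef_sum (bigD1 i)//=.
  rewrite coefZ coefXn eqxx mulr1 big1 ?addr0// => k /negbTE nik.
  by rewrite coefZ coefXn -val_eqE/= eq_sym in nik *; rewrite nik mulr0.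
have sb : (size bc <= n.+1)%N.
  rewrite size_map_poly; apply: (leq_trans (size_sum _ _ _));
    apply/bigmax_leqP => i _.
  by apply: (leq_trans (size_scale_leq _ _)); rewrite size_polyXn ltn_ord.
transitivity ((poly_rV bc *m horner_mx (companion n.+1 ac) (\prod_(i < d) f i)
    *m (\col_i (i.+1 == n.+1)%:R)) 0 0).
  rewrite -bE -prodE; set c := \col_i _; set c' := \col_i _.
  have -> : c' = map_mx (real_complex R) c.
    by apply/colP => i; rewrite !mxE rmorph_nat.
  by rewrite -!map_mxM [RHS]mxE.
rewrite (companion_functional acm sac uniq_rs mu_gt0 acE uP)// [LHS]big_seq
  [RHS]big_seq.
(* The Leibniz rule separates the jets of the exponential from those of [b u]. *)
apply: eq_bigr => l lrs; rewrite mulrAC mulrC nderivnM_horner.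
rewrite prednK ?mu_gt0//; apply: eq_bigr => j _; congr (_ * _).
exact: jS.
Qed.

End CarmaFunctional.

Theorem proposition3p8 (R : realType) (d p q : nat) (hd : (0 < d)%N)
    (a : 'I_d -> {poly R}) (b : 'cV[R]_p)
    (A := fun i : 'I_d => companion p (a i))
    (a1 := a (Ordinal hd)) (A1 := A (Ordinal hd)) :
  causal_carma q a b ->
  (forall i j : 'I_d, A i = A j) ->
  ~ (exists z : R[i], root (cpoly a1) z /\ root (cpoly (ma_poly b)) z) ->
  (forall s : 'rV[R]_d,
     (carma_kernel A b s)%:C =
     (\sum_(l \in ceigenvalues A1)
        ((alg_mult A1 l).-1)`!%:R^-1 *
        removable_value
          (cderive (alg_mult A1 l).-1
             (fun z : R[i] =>
                (z - l) ^+ alg_mult A1 l * cexp (z * (\sum_(i < d) s 0 i)%:C)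
                * ((cpoly (ma_poly b)).[z] / (cpoly a1).[z])))
          l)
     * (\1_nonneg_orthant s)%:C) /\
  ((ceigenvalues A1 #= `I_p)%card ->
   forall s : 'rV[R]_d,
     (carma_kernel A b s)%:C =
     (\sum_(l \in ceigenvalues A1)
        (cpoly (ma_poly b)).[l] / ((cpoly a1)^`()%R).[l]
        * cexp (l * (\sum_(i < d) s 0 i)%:C))
     * (\1_nonneg_orthant s)%:C).
Proof.
move=> [ltqp am sa _ _ _] eqA _.
have {ltqp} p_gt0 : (0 < p)%N by exact: leq_ltn_trans ltqp.
case: p p_gt0 b @A @A1 sa eqA => // n _ b A A1 sa eqA.
have {am sa} [am sa] : a1 \is monic /\ size a1 = n.+2 by split;
  [exact: am | exact: sa].
have acm : cpoly a1 \is monic by rewrite map_monic.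
have ac0 := monic_neq0 acm.
have sac : size (cpoly a1) = n.+2 by rewrite size_map_poly.
have charE : char_poly (map_mx (real_complex R) A1) = cpoly a1.
  by rewrite map_companion char_poly_companion.
have [rs [uniq_rs rsE acE simple]] := closed_field_factorization acm.
have [u uP] := cofactor_poly_inverse rs (fun l => mup l (cpoly a1)).
have mu_gt0 l : l \in rs -> (0 < mup l (cpoly a1))%N.
  by rewrite rsE -dvdp_XsubCl XsubC_dvd.
have eigE : ceigenvalues A1 = [set` rs].
  apply/seteqP; split => l;
    rewrite /ceigenvalues/= eigenvalue_root_char charE rsE//.
have kernelE (s : 'rV[R]_d) : (carma_kernel A b s)%:C =
    (\sum_(l <- rs) \sum_(j < mup l (cpoly a1))
      (\sum_(i < d) s 0 i)%:C ^+ j / j`!%:R * cexp (l * (\sum_(i < d) s 0 i)%:C)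
      * (cpoly (ma_poly b) * u l)^`N((mup l (cpoly a1)).-1 - j).[l])
    * (\1_nonneg_orthant s)%:C.
  rewrite /carma_kernel rmorphM -(carma_functional am sa uniq_rs rsE acE uP).
  by under eq_bigr do rewrite (eqA _ (Ordinal hd)).
have cof_neq0 l : (cofactor_poly rs (fun l => mup l (cpoly a1)) l).[l] != 0.
  exact: cofactor_poly_horner_neq0.
have acl l : l \in rs -> cpoly a1 = ('X - l%:P) ^+ mup l (cpoly a1)
    * cofactor_poly rs (fun l => mup l (cpoly a1)) l.
  by move=> lrs; rewrite mul_cofactor_poly.
split=> [s | card_p s]; rewrite kernelE eigE -fsbig_seq//; congr (_ * _).
  rewrite !big_seq; apply: eq_bigr => l lrs.
  rewrite /alg_mult charE.
  rewrite (cderive_removable_value _ _ (mu_gt0 l lrs) (acl l lrs) (cof_neq0 l)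
    (uP l)).
  by rewrite mulKf// pnatr_eq0 -lt0n fact_gt0.
(* As many distinct eigenvalues as the degree leave only simple roots. *)
have {}simple l : l \in rs -> mup l (cpoly a1) = 1%N.
  apply: simple; rewrite sac; congr _.+1.
  by apply: card_set_seqE => //; rewrite -eigE.
rewrite !big_seq; apply: eq_bigr => l lrs.
(* Only [j = 0] survives, with coefficient [b(l) u(l)]; it remains to see that [u(l)] is the inverse
   of [a'(l)]. *)
rewrite [in \sum_(_ < _) _]simple// big_ord1 expr0 divr1 mul1r nderivn0 hornerM.
rewrite mulrC; congr (_ * _); congr (_ * _).
move: (uP l); rewrite simple// expr1 dvdp_XsubCl /root hornerD hornerN hornerM
  hornerC.
rewrite subr_eq0 => /eqP uc1.
(* The derivative of [(z - l) c_l(z)] at [l] is [c_l(l)], and [u(l) c_l(l) = 1]. *)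
rewrite {1}(acl l lrs) simple// expr1 derivM derivXsubC mul1r hornerD hornerM
  hornerXsubC.
rewrite subrr mul0r addr0.
by apply: (mulIf (cof_neq0 l)); rewrite uc1 mulVf.
Qed.
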